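(* Let $G$ and $H$ be primitive graphs, and let $P:\mathcal{E}_G\times\mathcal{E}_H\to\mathbb{Z}$ be a function. Then $V(G,H,P)$ is a rational number. Furthermore, there exists an algorithm that computes $V(G,H,P)$ from $G,H,P$ in finite time.
   Context: A graph $G=(\mathcal{V}_G,\mathcal{E}_G)$ means a finite directed graph with vertex set $\mathcal{V}_G$ and edge set $\mathcal{E}_G$; each edge $e$ has a source $s(e)$ and a target $t(e)$; parallel edges and self-loops are allowed. A walk of length $n\ge 1$ is a tuple $(e_1,\dots,e_n)\in\mathcal{E}_G^n$ with $t(e_k)=s(e_{k+1})$ for $1\le k<n$; $\mathcal{W}_n(G)$ denotes the set of all walks of length $n$ in $G$. $G$ is irreducible if any two vertices are connected by a walk. A cycle is a walk with $s(e_1)=t(e_n)$. An irreducible graph is primitive if the greatest common divisor of all its cycle lengths is $1$. For $n\in\mathbb{N}$ set $V_n(G,H,P)=\max_{p\in\mathcal{W}_n(H)}\min_{q\in\mathcal{W}_n(G)}\sum_{i=1}^n P(q_i,p_i)$, and $V(G,H,P)=\lim_{n\to\infty}\frac1n V_n(G,H,P)$; this limit is known to exist. *)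

(* Defs.v *)
(* MathComp / MathComp-Analysis development. *)
From mathcomp Require Import all_boot all_order all_algebra.
From mathcomp Require Import all_classical all_reals all_analysis.

Set Implicit Arguments.
Unset Strict Implicit.
Unset Printing Implicit Defensive.

Import Order.TTheory GRing.Theory Num.Theory.
Import numFieldNormedType.Exports.

(** * Finite directed multigraphs *)

Record graph := Graph {
  vertex : finType;
  edge : finType;
  source : edge -> vertex;
  target : edge -> vertex
}.

Section Graphs.
Variable G : graph.

Definition consecutive (e f : edge G) : bool := target e == source f.

(* Walks have length at least 1, so the empty sequence is not a walk. *)
Definition is_walk (w : seq (edge G)) : bool :=
  if w is e :: w' then path consecutive e w' else false.

Definition is_walk_between (x y : vertex G) (w : seq (edge G)) : bool :=
  if w is e :: w'
  then [&& path consecutive e w', source e == x & target (last e w') == y]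
  else false.

Definition is_cycle (w : seq (edge G)) : Prop :=
  exists x, is_walk_between x x w.

Definition irreducible : Prop :=
  forall x y, exists w, is_walk_between x y w.

Definition walks (n : nat) : {set n.-tuple (edge G)} :=
  [set w : n.-tuple (edge G) | is_walk w].

End Graphs.

(* With this definition the gcd of the empty set is 0; in particular the graph
   without vertices is not primitive. *)
Definition is_gcd_of (L : nat -> Prop) (g : nat) : Prop :=
  (forall l, L l -> g %| l) /\
  (forall d, (forall l, L l -> d %| l) -> d %| g).

Definition primitive (G : graph) : Prop :=
  irreducible G /\
  is_gcd_of (fun l => exists2 w : seq (edge G), is_cycle w & size w = l) 1.

(** * The value [V(G, H, P)] *)

(* Maximum and minimum of a nonempty sequence; both are 0 on the empty one. *)
Definition maxz (s : seq int) : int := \big[Order.max/head 0%R s]_(x <- s) x.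
Definition minz (s : seq int) : int := \big[Order.min/head 0%R s]_(x <- s) x.

Section Value.
Variables (G H : graph) (P : edge G -> edge H -> int).

Definition score n (q : n.-tuple (edge G)) (p : n.-tuple (edge H)) : int :=
  (\sum_(i < n) P (tnth q i) (tnth p i))%R.

Definition Vn (n : nat) : int :=
  maxz [seq minz [seq score q p | q : n.-tuple (edge G) in walks G n]
       | p : n.-tuple (edge H) in walks H n].

Definition V (R : realType) : R := limn (fun n => (Vn n)%:~R / n%:R : R)%R.

End Value.

(** * Algorithms: partial recursive functions *)

(* Programs for the k-ary partial recursive functions in the sense of Kleene. *)
Inductive recfun : nat -> Type :=
| Zero k : recfun k
| Succ : recfun 1
| Proj k : 'I_k -> recfun k
| Comp k m : recfun m -> ('I_m -> recfun k) -> recfun k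
| Prec k : recfun k -> recfun k.+2 -> recfun k.+1
| Mu k : recfun k.+1 -> recfun k.

(* [evaluates f x y]: the program [f] halts on input [x] with output [y].
   - [Prec f g] on (n, x): [r] is the sequence of intermediate values,
     r 0 = f(x), r (i+1) = g(i, r i, x), and the output is r n.
   - [Mu f] on x: the least n with f(n, x) = 0, where f(i, x) must be defined
     (and nonzero, with value [(v i).+1]) for all i < n. *)
Fixpoint evaluates k (f : recfun k) : k.-tuple nat -> nat -> Prop :=
  match f in recfun k return k.-tuple nat -> nat -> Prop with
  | Zero _ => fun _ y => y = 0
  | Succ => fun x y => y = (thead x).+1
  | Proj _ i => fun x y => y = tnth x i
  | @Comp _ m f g => fun x y => exists z : m.-tuple nat,
      (forall i, evaluates (g i) x (tnth z i)) /\ evaluates f z y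
  | Prec _ f g => fun x y => exists r : nat -> nat,
      [/\ evaluates f [tuple of behead x] (r 0),
          forall i, i < thead x ->
            evaluates g [tuple of i :: r i :: behead x] (r i.+1)
        & y = r (thead x)]
  | Mu _ f => fun x y => exists v : nat -> nat,
      (forall i, i < y -> evaluates f [tuple of i :: x] (v i).+1) /\
      evaluates f [tuple of y :: x] 0
  end.

Lemma evaluates_functional k (f : recfun k) x y1 y2 :
  evaluates f x y1 -> evaluates f x y2 -> y1 = y2.
Proof.
elim: f x y1 y2 => {k} [k|| k i|k m f IHf g IHg|k f IHf g IHg|k f IHf] x y1 y2.
- by move=> /= -> ->.
- by move=> /= -> ->.
- by move=> /= -> ->.
- move=> /= [z1 [gz1 fz1]] [z2 [gz2 fz2]].
  have zE : z1 = z2 by apply: eq_from_tnth => i; exact: IHg (gz1 i) (gz2 i).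
  by move: fz1; rewrite zE => fz1; exact: IHf fz1 fz2.
- move=> /= [r1 [f1 g1 ->]] [r2 [f2 g2 ->]].
  suff rE i : i <= thead x -> r1 i = r2 i by exact: rE.
  elim: i => [_|i IHi ix]; first exact: IHf f1 f2.
  by move: (g1 i ix); rewrite (IHi (ltnW ix)) => {}g1; exact: IHg g1 (g2 i ix).
- move=> /= [v1 [pos1 zero1]] [v2 [pos2 zero2]].
  have [y12|y21|//] := ltngtP y1 y2.
  + by have := IHf _ _ _ zero1 (pos2 _ y12).
  + by have := IHf _ _ _ zero2 (pos1 _ y21).
Qed.

(** * Encoding of inputs and outputs by natural numbers *)

Definition int_code (z : int) : nat :=
  match z with Posz n => n.*2 | Negz n => n.*2.+1 end.

Definition rat_code (q : rat) : nat :=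
  CodeSeq.code [:: int_code (numq q); int_code (denq q)].

(* Vertices and edges are numbered along their enumerations.  Any numbering can
   be obtained this way by transporting the graph to ['I_n] and ['I_m]. *)
Definition graph_code (G : graph) : nat :=
  CodeSeq.code
    [:: #|vertex G|; #|edge G|;
        CodeSeq.code [seq nat_of_ord (enum_rank (source e)) | e <- enum (edge G)];
        CodeSeq.code [seq nat_of_ord (enum_rank (target e)) | e <- enum (edge G)]].

Definition instance_code (G H : graph) (P : edge G -> edge H -> int) : nat :=
  CodeSeq.code
    [:: graph_code G; graph_code H;
        CodeSeq.code [seq int_code (P e f) | e <- enum (edge G),
                                             f <- enum (edge H)]].

(* Main.v *)
(* For a word p over the edges of H, let u_p v be the least cost of a walk in G
   ending at v and read against p.  Reading one more edge of H applies a min-plus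
   matrix to u_p, and since G is primitive any two entries of u_p differ by a
   bounded amount.  So, up to additive constants, the vectors u_p take finitely
   many values, and V is the maximal mean weight of a cycle in the finite graph
   whose states are such a vector together with a vertex of H: a rational number.

   That V = a / b is certified by finite data.  A closed walk in H with potentials
   that grow by at most b * cost - a along each edge of G shows V >= a / b; a
   finite family of pairs (vertex of H, potential on G), closed under reading
   edges of H, shows V <= a / b.  Checking certificates only involves bounded
   quantifiers, so an unbounded search for a certificate computes V. *)
Require Import Defs.
From mathcomp Require Import all_boot all_order all_algebra.
From mathcomp Require Import all_classical all_reals all_analysis.
From mathcomp Require Import zify ring lra.

Set Implicit Arguments.
Unset Strict Implicit.
Unset Printing Implicit Defensive.

Import Order.TTheory GRing.Theory Num.Theory.
Import numFieldNormedType.Exports.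

(** * Closure properties of computable functions *)

(** The arity is kept out of the type of [F]: only its values on lists of length [k] matter.
    Arguments can thus be named by [nth 0] and parameters dropped by [behead]. *)
Definition computable k (F : seq nat -> nat) : Prop :=
  exists r : recfun k, forall x : k.-tuple nat, evaluates r x (F x).

Lemma computable_ext k (F F' : seq nat -> nat) :
  (forall x : k.-tuple nat, F x = F' x) -> computable k F -> computable k F'.
Proof. by move=> FF' [r rF]; exists r => x; rewrite -FF'. Qed.

Lemma computable_comp m k f (g : nat -> seq nat -> nat) :
  computable m f -> (forall i, i < m -> computable k (g i)) ->
  computable k (fun s => f (mkseq (fun i => g i s) m)).
Proof.
move=> [rf rfP] gP.
have /choice [rg rgP] : forall i : 'I_m, exists r : recfun k,
    forall x : k.-tuple nat, evaluates r x (g i x).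
  by move=> i; exact: gP.
exists (Comp rf rg) => x /=.
have sz : size (mkseq (fun i => g i x) m) == m by rewrite size_mkseq.
exists (Tuple sz); split; last exact: rfP.
by move=> i; rewrite (tnth_nth 0) nth_mkseq.
Qed.

Lemma computable_nth k i : computable k (nth 0 ^~ i).
Proof.
have [ik|ki] := ltnP i k.
  by exists (Proj (Ordinal ik)) => x /=; rewrite (tnth_nth 0).
by exists (Zero k) => x /=; rewrite nth_default // size_tuple.
Qed.

Lemma computable_var k i F : (forall s, F s = nth 0 s i) -> computable k F.
Proof. by move=> FE; apply: computable_ext (computable_nth k i) => x. Qed.

Lemma computable1 f : computable 1 (fun s => f (nth 0 s 0)) ->
  forall k F, computable k F -> computable k (fun s => f (F s)).
Proof. by move=> cf k F cF; exact: (computable_comp (g := fun=> F) cf). Qed.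

Lemma computable2 f : computable 2 (fun s => f (nth 0 s 0) (nth 0 s 1)) ->
  forall k F F', computable k F -> computable k F' ->
  computable k (fun s => f (F s) (F' s)).
Proof.
move=> cf k F F' cF cF'.
by apply: (computable_comp (g := fun i => if i is 0 then F else F') cf) => -[].
Qed.

Lemma computable_succ k F : computable k F -> computable k (fun s => (F s).+1).
Proof.
apply: (computable1 (f := S)).
by exists Succ => x /=; rewrite /thead (tnth_nth 0).
Qed.

Lemma computable_const k n : computable k (fun=> n).
Proof.
elim: n => [|n]; first by exists (Zero k).
exact: computable_succ.
Qed.

Lemma map_iota_nth (f : nat -> nat) m (s : seq nat) :
  (forall i, f (m + i) = nth 0 s i) -> map f (iota m (size s)) = s.
Proof.
move=> fE; apply: (@eq_from_nth _ 0); first by rewrite size_map size_iota.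
move=> i; rewrite size_map size_iota => ltis.
by rewrite (nth_map 0) ?size_iota // nth_iota.
Qed.

Lemma computable_iteri k N A g :
  computable k N -> computable k A ->
  computable k.+2 (fun s => g (nth 0 s 0) (nth 0 s 1) (behead (behead s))) ->
  computable k (fun s => iteri (N s) (fun i y => g i y s) (A s)).
Proof.
move=> cN [ra raP] [rg rgP].
have cP : computable k.+1 (fun s =>
    iteri (nth 0 s 0) (fun i y => g i y (behead s)) (A (behead s))).
  exists (Prec ra rg) => x /=.
  exists (fun n => iteri n (fun i y => g i y (behead x)) (A (behead x))).
  split=> [|i _|] /=.
  - exact: (raP [tuple of behead x]).
  - exact: (rgP [tuple of i :: _ :: behead x]).
  - by rewrite /thead (tnth_nth 0).
(* [Prec] recurses on its first argument, so the bound [N s] is put in front of the parameters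
   [s]. *)
have := computable_comp
  (g := fun i s => if i is j.+1 then nth 0 s j else N s) cP.
move=> /(_ k) cC; apply: computable_ext (cC _) => [x|[|i] _ //].
  rewrite /=; have -> // :
      [seq (if i is j.+1 then nth 0 x j else N x) | i <- iota 1 k] = x.
  by rewrite -[k in iota 1 k](size_tuple x) map_iota_nth.
exact: computable_nth.
Qed.

Lemma computable_iter k N A g :
  computable k N -> computable k A ->
  computable k.+1 (fun s => g (nth 0 s 0) (behead s)) ->
  computable k (fun s => iter (N s) (fun y => g y s) (A s)).
Proof.
move=> cN cA cg.
(* The step function gets an extra leading argument, the loop counter, which it ignores. *)
have cB2 : computable k.+2 (fun s => g (nth 0 s 1) (behead (behead s))).
  have := computable_comp (g := fun i s => nth 0 s i.+1) cg.
  move=> /(_ k.+2) cC; apply: computable_ext (cC _) => [x|i _]; last first.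
    exact: computable_nth.
  have sz : size (behead (behead x)) = k by rewrite !size_behead size_tuple.
  congr (g _ _) => /=; rewrite -[k in iota 1 k]sz map_iota_nth // => i.
  by rewrite !nth_behead.
apply: computable_ext (computable_iteri (g := fun=> g) cN cA cB2) => x.
by elim: (N x) => //= n ->.
Qed.

(** * Arithmetic, Boolean connectives and bounded quantifiers *)

Lemma computable_addn k F F' : computable k F -> computable k F' ->
  computable k (fun s => F s + F' s).
Proof.
apply: (computable2 (f := addn)).
have := computable_iter (g := fun y _ => y.+1)
  (computable_nth 2 0) (computable_nth 2 1) (computable_succ (computable_nth _ 0)).
by apply: computable_ext => x; rewrite iter_succn addnC.
Qed.

Lemma computable_muln k F F' : computable k F -> computable k F' ->
  computable k (fun s => F s * F' s).
Proof.
apply: (computable2 (f := muln)).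
have cg : computable 3 (fun s => nth 0 (behead s) 1 + nth 0 s 0).
  apply: computable_addn (computable_nth _ _).
  by apply: (@computable_var _ 2) => s; rewrite nth_behead.
have := computable_iter (g := fun y s => nth 0 s 1 + y)
  (computable_nth 2 0) (computable_const 2 0) cg.
by apply: computable_ext => x; rewrite iter_addn_0 mulnC.
Qed.

Lemma computable_expn k F F' : computable k F -> computable k F' ->
  computable k (fun s => F s ^ F' s).
Proof.
apply: (computable2 (f := expn)).
have cg : computable 3 (fun s => nth 0 (behead s) 0 * nth 0 s 0).
  apply: computable_muln (computable_nth _ _).
  by apply: (@computable_var _ 1) => s; rewrite nth_behead.
have := computable_iter (g := fun y s => nth 0 s 0 * y)
  (computable_nth 2 1) (computable_const 2 1) cg.
by apply: computable_ext => x; rewrite iter_muln_1.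
Qed.

Lemma computable_pred k F : computable k F -> computable k (fun s => (F s).-1).
Proof.
apply: (computable1 (f := predn)).
have := computable_iteri (g := fun i _ _ => i)
  (computable_nth 1 0) (computable_const 1 0) (computable_nth _ 0).
by apply: computable_ext => x; case: (nth _ _ _).
Qed.

Lemma computable_subn k F F' : computable k F -> computable k F' ->
  computable k (fun s => F s - F' s).
Proof.
apply: (computable2 (f := subn)).
have := computable_iter (g := fun y _ => y.-1)
  (computable_nth 2 1) (computable_nth 2 0) (computable_pred (computable_nth _ 0)).
by apply: computable_ext => x; rewrite iter_predn.
Qed.

(** Truth values enter as 0 and 1 through the coercion to [nat], so connectives reduce to
    arithmetic, and a bounded universal quantifier to an iterated product. *)
Lemma computable_not k (F : seq nat -> bool) :
  computable k F -> computable k (fun s => ~~ F s).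
Proof.
move=> cF; have := computable_subn (computable_const k 1) cF.
by apply: computable_ext => x; case: (F x).
Qed.

Lemma computable_and k (F F' : seq nat -> bool) :
  computable k F -> computable k F' -> computable k (fun s => F s && F' s).
Proof.
move=> cF cF'; have := computable_muln cF cF'.
by apply: computable_ext => x; rewrite mulnb.
Qed.

Lemma computable_implb k (F F' : seq nat -> bool) :
  computable k F -> computable k F' -> computable k (fun s => F s ==> F' s).
Proof.
move=> cF cF'; have := computable_not (computable_and cF (computable_not cF')).
by apply: computable_ext => x; case: (F x); case: (F' x).
Qed.

Lemma computable_leq k F F' : computable k F -> computable k F' ->
  computable k (fun s => F s <= F' s).
Proof.
move=> cF cF'.
have := computable_subn (computable_const k 1) (computable_subn cF cF').
by apply: computable_ext => x; rewrite /leq; case: (F x - F' x).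
Qed.

Lemma computable_eqn k F F' : computable k F -> computable k F' ->
  computable k (fun s => F s == F' s).
Proof.
move=> cF cF'.
have := computable_and (computable_leq cF cF') (computable_leq cF' cF).
by apply: computable_ext => x; rewrite eqn_leq.
Qed.

Lemma computable_if k (B : seq nat -> bool) F F' :
  computable k B -> computable k F -> computable k F' ->
  computable k (fun s => if B s then F s else F' s).
Proof.
move=> cB cF cF'; have := computable_addn (computable_muln cB cF)
  (computable_muln (computable_not cB) cF').
by apply: computable_ext => x; case: (B x); rewrite ?mul1n ?mul0n ?addn0.
Qed.

Lemma computable_all k N (B : nat -> seq nat -> bool) : computable k N ->
  computable k.+1 (fun s => B (nth 0 s 0) (behead s)) ->
  computable k (fun s => all (B ^~ s) (iota 0 (N s))).
Proof.
move=> cN cB.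
have cB2 : computable k.+2 (fun s => B (nth 0 s 0) (behead (behead s))).
  have := computable_comp (g := fun i s => nth 0 s (if i is 0 then 0 else i.+1)) cB.
  move=> /(_ k.+2) cC; apply: computable_ext (cC _) => [x|i _]; last first.
    exact: computable_nth.
  have sz : size (behead (behead x)) = k by rewrite !size_behead size_tuple.
  congr (nat_of_bool (B _ _)) => /=; rewrite -[k in iota 1 k]sz map_iota_nth // => i.
  by rewrite !nth_behead.
have := computable_iteri (g := fun i y s => y * B i s)
  cN (computable_const k 1) (computable_muln (computable_nth k.+2 1) cB2).
apply: computable_ext => x; elim: (N x) => // n IHn.
by rewrite [LHS]/= IHn -addn1 iotaD all_cat /= add0n andbT mulnb.
Qed.

Lemma computable_has k N (B : nat -> seq nat -> bool) : computable k N ->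
  computable k.+1 (fun s => B (nth 0 s 0) (behead s)) ->
  computable k (fun s => has (B ^~ s) (iota 0 (N s))).
Proof.
move=> cN /computable_not cB.
have := computable_not (computable_all (B := fun i s => ~~ B i s) cN cB).
by apply: computable_ext => x; rewrite -has_predC; congr nat_of_bool;
  apply: eq_has => i /=; rewrite negbK.
Qed.

Lemma computable_odd k F : computable k F -> computable k (fun s => odd (F s)).
Proof.
apply: (computable1 (f := odd)).
have := computable_iter (g := fun y _ => 1 - y)
  (computable_nth 1 0) (computable_const 1 0)
  (computable_subn (computable_const _ 1) (computable_nth _ 0)).
by apply: computable_ext => x; elim: (nth _ _ _) => //= n ->; case: (odd n).
Qed.

Lemma computable_half k F : computable k F -> computable k (fun s => (F s)./2).
Proof.
apply: (computable1 (f := half)).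
have := computable_iteri (g := fun i y _ => odd i + y)
  (computable_nth 1 0) (computable_const 1 0)
  (computable_addn (computable_odd (computable_nth _ 0))
  (computable_nth _ 1)).
by apply: computable_ext => x; elim: (nth _ _ _) => //= n ->; rewrite uphalf_half.
Qed.

(** [Mu] stops at the first zero, so it is applied to the negated test. One program serves all
    inputs; it is only claimed to halt where a witness exists. *)
Lemma evaluates_search (f : nat -> nat -> bool) (g : nat -> nat) :
  computable 2 (fun s => f (nth 0 s 1) (nth 0 s 0)) ->
  computable 1 (fun s => g (nth 0 s 0)) ->
  exists A : recfun 1, forall x, (exists w, f x w) ->
    exists2 w, f x w & evaluates A [tuple x] (g w).
Proof.
move=> /computable_not [rf rfP] [rg rgP].
exists (Comp rg (fun=> Mu rf)) => x exw; exists (ex_minn exw).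
  by case: ex_minnP.
case: ex_minnP => w fxw min_w /=; exists [tuple w]; split; last exact: rgP.
move=> i; rewrite (_ : tnth [tuple w] i = w); last by rewrite (tnth_nth 0) ord1.
(* Before the least witness the negated test has value 1, the successor of 0. *)
exists (fun=> 0); split=> [j jw|]; last first.
  by have := rfP [tuple w; x]; rewrite /= fxw.
have nfj : ~~ f x j by apply: contraTN jw => fxj; rewrite -leqNgt min_w.
by have := rfP [tuple j; x]; rewrite /= nfj.
Qed.

(** * Routes and primitive graphs *)

Section Routes.
Variable G : graph.
Implicit Types (x y z : vertex G) (p : seq (edge G)).

(* Unlike a walk, a route may be empty. *)
Fixpoint route x p y : bool :=
  if p is e :: p' then (source e == x) && route (target e) p' y else x == y.

Lemma route_catP x p1 p2 z :
  reflect (exists2 y, route x p1 y & route y p2 z) (route x (p1 ++ p2) z).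
Proof.
elim: p1 x => [|e p1 IHp] x /=.
  by apply: (iffP idP) => [|[y /eqP ->//]]; exists x.
case: eqP => [_|_] /=; last by constructor=> -[].
exact: IHp.
Qed.

Lemma is_walk_betweenE x y e p : is_walk_between x y (e :: p) = route x (e :: p) y.
Proof.
rewrite /= andbCA; congr (_ && _).
elim: p e => //= f p IHp e; rewrite -IHp /consecutive eq_sym andbA.
by case: eqP.
Qed.

Lemma is_walkE e p : is_walk (e :: p) = route (source e) (e :: p) (target (last e p)).
Proof. by rewrite -is_walk_betweenE /= !eqxx !andbT. Qed.

Lemma is_walk_route x p y : route x p y -> 0 < size p -> is_walk p.
Proof.
by case: p => // e p; rewrite -is_walk_betweenE => /and3P[].
Qed.

Lemma walk_routeP p : is_walk p -> exists x y, route x p y.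
Proof. by case: p => // e p; rewrite is_walkE; do 2 eexists; eassumption. Qed.

Lemma route_functional x p y y' : route x p y -> route x p y' -> y = y'.
Proof.
elim: p x => [|e p IHp] x /=; first by move=> /eqP <- /eqP.
by move=> /andP[_ /IHp +] /andP[_]; apply.
Qed.

(** Pigeonhole: the prefixes of length 0 up to the number of vertices outnumber the vertices, so two
    of them end at the same vertex, and the piece between them is closed. *)
Lemma route_extract_cycle x p y : #|vertex G| <= size p -> route x p y ->
  exists z p1 c p2, [/\ p = p1 ++ c ++ p2, route x p1 z, route z c z, route z p2 y
    & 0 < size c <= #|vertex G|].
Proof.
move=> szp xpy.
have v_ex i : exists z, route x (take i p) z && route z (drop i p) y.
  by move: xpy; rewrite -{1}(cat_take_drop i p) => /route_catP [z xz zy];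
     exists z; rewrite xz.
pose f (i : 'I_#|vertex G|.+1) := xchoose (v_ex i).
have f_ex (i : 'I_#|vertex G|.+1) : route x (take i p) (f i) /\ route (f i) (drop i p) y.
  by have /andP := xchooseP (v_ex i).
have : ~~ injectiveb f.
  apply/negP => /injectiveP /leq_card; rewrite card_ord ltnn //.
move=> /injectivePn [i [j]]; wlog ij : i j / i < j.
  move=> H ij eqf; have [lt|lt|] := ltngtP i j; first exact: H ij eqf.
    by apply: H lt _ (esym eqf); rewrite eq_sym.
  by move=> /val_inj e; rewrite e eqxx in ij.
move=> _ eqf.
have [xi iy] := f_ex i; have [xj jy] := f_ex j.
have jp : j <= size p by rewrite (leq_trans _ szp) // -ltnS.
exists (f i), (take i p), (drop i (take j p)), (drop j p).
have cut : take j p = take i p ++ drop i (take j p).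
  by rewrite -[in LHS](cat_take_drop i (take j p)) take_takel // ltnW.
split=> //.
- by rewrite catA -cut cat_take_drop.
- move: xj; rewrite {1}cut -eqf => /route_catP [z xz].
  by rewrite -(route_functional xi xz).
- by rewrite eqf.
- rewrite size_drop size_takel // subn_gt0 ij /=.
  by rewrite (leq_trans (leq_subr _ _)) // -ltnS.
Qed.

End Routes.

(** The least positive difference [g] of two elements divides every element, hence equals 1. Two
    consecutive elements [b] and [b + 1] then generate every number from [b * b] on. *)
Lemma numerical_semigroup (L : nat -> Prop) :
  L 0 -> (forall a b, L a -> L b -> L (a + b)) ->
  (forall d, (forall a, L a -> d %| a) -> d = 1) ->
  exists N, forall n, N <= n -> L n.
Proof.
move=> L0 LD gcdL.
have LM n a : L a -> L (n * a).
  by move=> La; elim: n => // n IHn; rewrite mulSn; apply: LD.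
pose D n := exists2 b, L b & L (b + n).
(* Otherwise 0 is the only element, and the gcd hypothesis fails at [d = 0]. *)
have exD : exists n, `[< D n /\ 0 < n >].
  apply: contrapT => /forallNP nD.
  have /gcdL // : forall a, L a -> 0 %| a.
  move=> a La; have [->|a0] := posnP a => //.
  by case: (nD a); apply/asboolP; split=> //; exists 0.
have [g /asboolP [[b Lb Lbg] g0] min_g] := ex_minnP exD.
have g1 : g = 1.
  apply: gcdL => a La.
  have [r0|r0] := posnP (a %% g); first by rewrite /dvdn r0.
  have /min_g : `[< D (a %% g) /\ 0 < a %% g >].
    (* With [k = a %/ g], the elements [k * (b + g)] and [k * b + a] differ by the remainder of [a]
       modulo [g]. *)
    apply/asboolP; split=> //; exists (a %/ g * (b + g)); first exact: LM.
    rewrite mulnDr -addnA -divn_eq; exact: LD (LM _ _ Lb) La.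
  by rewrite leqNgt ltn_mod g0.
exists (b * b) => n bn; rewrite {}g1 in Lbg.
have [b0|b0] := posnP b.
  by rewrite b0 in Lbg; rewrite -[n]muln1; apply: LM.
(* Keeps the coefficient of [b] in the decomposition of [n] below from being truncated. *)
have rq : n %% b <= n %/ b.
  by rewrite (leq_trans (ltnW (ltn_pmod _ b0))) // leq_divRL.
have -> : n = (n %/ b - n %% b) * b + n %% b * (b + 1).
  by rewrite mulnDr muln1 addnA -mulnDl subnK // -divn_eq.
exact: LD (LM _ _ Lb) (LM _ _ Lbg).
Qed.

(** Without vertices there are no cycles, so 0 would divide all cycle lengths and hence 1. *)
Lemma primitive_vertex G : primitive G -> inhabited (vertex G).
Proof.
move=> [_ [_ /(_ 0) gcd1]]; apply: contrapT => nV.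
have // : 0 %| 1 by apply: gcd1 => l [[|e c] [x]] //; case: nV.
Qed.

Lemma irreducible_route G (x y : vertex G) : irreducible G ->
  exists2 p, route x p y & 0 < size p.
Proof.
by move=> /(_ x y) [[|e p]] // ; rewrite is_walk_betweenE; exists (e :: p).
Qed.

(** The lengths of closed routes at a base vertex [x] form a semigroup containing all large numbers.
    Every pair of vertices is joined through [x], and a closed route at [x] pads the connection to a
    common length. *)
Lemma primitive_routes G : primitive G ->
  exists d, forall x y : vertex G, exists2 p, route x p y & size p = d.
Proof.
move=> primG; have [x] := primitive_vertex primG.
have [irrG [_ gcdG]] := primG.
have irr y z := irreducible_route y z irrG.
pose L n := exists2 p, route x p x & size p = n.
have [|a b [p xpx <-] [p' xpx' <-]|d dL|N LN] := @numerical_semigroup L.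
- by exists [::] => //=.
- by exists (p ++ p'); [apply/route_catP; exists x | rewrite size_cat].
- suff : d %| 1 by rewrite dvdn1 => /eqP.
  apply: gcdG => _ [c [y ycy] <-].
  have {}ycy : route y c y by case: c ycy => // e c; rewrite is_walk_betweenE.
  have [p xpy _] := irr x y; have [p' ypx _] := irr y x.
  (* A cycle at another vertex [y] is reached by a detour from [x]; [d] divides the length of the
     detour with and without the cycle, hence the cycle length. *)
  have Lpp : L (size p + size p').
    by exists (p ++ p'); [apply/route_catP; exists y | rewrite size_cat].
  have Lpcp : L (size c + (size p + size p')).
    exists (p ++ c ++ p'); last by rewrite !size_cat addnCA.
    by do 2 (apply/route_catP; exists y => //).
  by have := dL _ Lpcp; rewrite dvdn_addl // dL.
have /choice [a aP] : forall y, exists p, route y p x.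
  by move=> y; have [p] := irr y x; exists p.
have /choice [b bP] : forall y, exists p, route x p y.
  by move=> y; have [p] := irr x y; exists p.
pose A := \sum_y size (a y); pose B := \sum_y size (b y).
exists (A + N + B) => y z.
have yA : size (a y) <= A by rewrite /A (bigD1 y) //= leq_addr.
have zB : size (b z) <= B by rewrite /B (bigD1 z) //= leq_addr.
have [|p xpx pE] := LN ((A - size (a y)) + N + (B - size (b z))); first by lia.
exists (a y ++ p ++ b z); last by rewrite !size_cat pE; lia.
by do 2 (apply/route_catP; exists x => //).
Qed.

(** * Cycles of maximal mean weight *)

Section MaxCycleMean.
Local Open Scope ring_scope.

Lemma int_bounded_has_max (A : int -> Prop) :
  (exists z, A z) -> (exists C, forall z, A z -> z <= C) ->
  exists2 m, A m & forall z, A z -> z <= m.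
Proof.
move=> [z0 Az0] [C AC].
pose Q n := `[< A (C - n%:Z) >].
have [n Qn] : exists n, Q n.
  exists `|C - z0|%N; apply/asboolP.
  by have := AC _ Az0; move=> le; rewrite gez0_abs ?subr_ge0 // subKr.
have [m /asboolP Am min_m] := ex_minnP (ex_intro _ n Qn).
exists (C - m%:Z) => // z Az.
have := AC _ Az => zC.
have /min_m : Q `|C - z|%N.
  by apply/asboolP; rewrite gez0_abs ?subr_ge0 // subKr.
lia.
Qed.

(* The maximum mean is attained on the finitely many cycles that are no longer
   than the number of vertices, and every walk is obtained by inserting such
   cycles into a short one. *)
Lemma max_cycle_mean (G : graph) (w : edge G -> int) (x0 y0 : vertex G) p0 :
  route x0 p0 y0 -> (#|vertex G| <= size p0)%N ->
  exists q : rat, let r e := denq q * w e - numq q in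
    (exists2 c, (0 < size c)%N /\ (exists x, route x c x) & \sum_(e <- c) r e = 0) /\
    (exists C, forall x p y, route x p y -> \sum_(e <- p) r e <= C).
Proof.
move=> xpy0 szp0; set N := #|vertex G| in szp0.
(* The long route supplies one short cycle, so that the maximum below is over a nonempty set. *)
have [x1 [_ [c1 [_ [_ _ c1P _ c1N]]]]] := route_extract_cycle szp0 xpy0.
pose T := {k : 'I_N.+1 & k.-tuple (edge G)}.
pose word (t : T) : seq (edge G) := tagged t.
pose good (t : T) := (0 < size (word t))%N && [exists x, route x (word t) x].
have mk_T c x : route x c x -> (0 < size c <= N)%N -> exists2 t, good t & word t = c.
  move=> xcx /andP[c0 cN].
  pose k : 'I_N.+1 := Ordinal (cN : (size c < N.+1)%N).
  exists (Tagged (fun k : 'I_N.+1 => k.-tuple (edge G)) (i := k) (in_tuple c)) => //.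
  by rewrite /good /word /= c0; apply/existsP; exists x.
have [t1 good1 _] := mk_T _ _ c1P c1N.
pose mean t : rat := (\sum_(e <- word t) w e)%:~R / (size (word t))%:R.
pose t := [arg max_(t > t1 | good t) mean t]%O.
have [good_t max_t] : good t /\ forall t', good t' -> mean t' <= mean t.
  by rewrite /t; case: Order.TotalTheory.arg_maxP.
pose q := mean t.
exists q => r.
(* The reduced weight of a nonempty [c] has the sign of its mean minus [q]; the factor [denq q] only
   keeps it an integer. *)
have sum_r c : (\sum_(e <- c) r e)%:~R =
    (denq q)%:~R * ((\sum_(e <- c) w e)%:~R - q * (size c)%:R) :> rat.
  rewrite sumrB -mulr_sumr big_const_seq count_predT iter_addr_0.
  rewrite rmorphB rmorphM /= mulrBr mulrA [_ * q]mulrC -numqE.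
  by rewrite rmorphMn /= mulr_natr.
have /andP[t0 /existsP[x xtx]] := good_t.
have size_neq0 s : good s -> (size (word s))%:R != 0 :> rat.
  by case/andP => s0 _; rewrite pnatr_eq0 -lt0n.
have cycle_le0 c z : route z c z -> (0 < size c <= N)%N -> \sum_(e <- c) r e <= 0.
  move=> zcz cN; have [s good_s sE] := mk_T _ _ zcz cN.
  rewrite -(ler_int rat) sum_r -sE.
  rewrite pmulr_rle0 ?ltr0z ?denq_gt0 // subr_le0.
  rewrite -ler_pdivrMr ?max_t // ltr0n.
  by case/andP: good_s.
split.
  exists (word t); first by split=> //; exists x.
  apply/eqP; rewrite -(eqr_int rat) sum_r mulf_eq0 subr_eq0 /q /mean.
  by rewrite divfK ?eqxx ?orbT ?size_neq0.
pose K := \sum_e `|r e|.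
have rK e : r e <= K.
  by rewrite (le_trans (ler_norm _)) // /K (bigD1 e) //= lerDl sumr_ge0.
have K0 : 0 <= K by exact: sumr_ge0.
(* Once all cycles are cut out, fewer than [N] edges remain, each of reduced weight at most [K]. *)
exists (K *+ N) => x' p y; have [n] := ubnP (size p).
elim: n p => // n IHn p; rewrite ltnS => pn x'py.
have [Np|pN] := leqP N (size p).
  have [z [p1 [c [p2 [pE xz zcz zy /[dup] cN /andP[c0 _]]]]]] :=
    route_extract_cycle Np x'py.
  (* Cutting out [c] does not lower the total, as its reduced weight is at most 0. *)
  have := IHn (p1 ++ p2); rewrite pE !big_cat /= addrCA => IH.
  apply: le_trans (IH _ _).
  - by rewrite gerDr (cycle_le0 _ z).
  - by rewrite (leq_trans _ pn) // pE !size_cat; lia.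
  - by apply/route_catP; exists z.
apply: (@le_trans _ _ (K *+ size p)); last by rewrite ler_wpMn2l // ltnW.
rewrite -count_predT -iter_addr_0 -big_const_seq.
exact: ler_sum.
Qed.

End MaxCycleMean.

(** * Certificates for the value *)

Section Certificates.
Local Open Scope ring_scope.
Variables (G H : graph) (P : edge G -> edge H -> int).
Implicit Types (a b : int) (q : seq (edge G)).

Definition cost q (p : seq (edge H)) : int := \sum_(x <- zip q p) P x.1 x.2.

Lemma cost_cons e q f p : cost (e :: q) (f :: p) = P e f + cost q p.
Proof. by rewrite /cost big_cons. Qed.

(** The potential depends on the position in the closed walk, not on the vertex of [H] there, since
    the walk may revisit a vertex. Only indices up to [n] matter, so a finite table describes the
    certificate. *)
Definition lower_cert a b n (p : nat -> edge H) (phi : nat -> vertex G -> int) :=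
  [/\ (0 < n)%N, p n = p 0%N,
      forall i, (i < n)%N -> target (p i) = source (p i.+1),
      forall v, phi n v = phi 0%N v &
      forall i e, (i < n)%N ->
        phi i.+1 (target e) + a <= phi i (source e) + b * P e (p i)].

(** A vertex of [H] may occur with several potentials. The edge [e] is chosen by its target [v], so
    a response in [G] is assembled backwards from its last vertex. *)
Definition upper_cert a b m (h : nat -> vertex H) (psi : nat -> vertex G -> int) :=
  (forall x, exists2 j, (j < m)%N & h j = x) /\
  forall j f, (j < m)%N -> source f = h j -> exists k,
    [/\ (k < m)%N, h k = target f & forall v, exists2 e, target e = v &
      psi j (source e) + b * P e f <= psi k v + a].

Lemma potential_bound m (phi : nat -> vertex G -> int) :
  exists C : int, forall i v, (i < m)%N -> `|phi i v| <= C.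
Proof.
exists (\sum_(i < m) \sum_v `|phi i v|) => i v im.
rewrite (bigD1 (Ordinal im)) //= (bigD1 v) //= -addrA lerDl addr_ge0 ?sumr_ge0 //.
by move=> *; apply: sumr_ge0.
Qed.

(** The word [w] runs around the closed walk periodically. Along any route in [G] the potential
    inequalities telescope, leaving only the potentials at the two ends. *)
Lemma lower_cert_bound a b n p phi : lower_cert a b n p phi ->
  exists C : int, forall N, (0 < N)%N -> exists2 w, is_walk w /\ size w = N &
    forall x q y, route x q y -> size q = N -> a *+ N <= b * cost q w + C.
Proof.
move=> [n0 pn pS phin phiS].
have modS i : (i.+1 %% n = if (i %% n).+1 == n then 0 else (i %% n).+1)%N.
  have := ltn_pmod i n0; rewrite -[in LHS]addn1 -modnDml addn1 leq_eqVlt.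
  by case: eqP => [-> _|_ /= lt]; rewrite ?modnn // modn_small.
pose p' i := p (i %% n)%N; pose phi' i := phi (i %% n)%N.
have pS' i : target (p' i) = source (p' i.+1).
  rewrite /p' pS ?ltn_pmod // modS.
  by case: eqP => // ->; rewrite pn.
have phiS' i e : phi' i.+1 (target e) + a <= phi' i (source e) + b * P e (p' i).
  have := phiS _ e (ltn_pmod i n0); rewrite /phi' modS.
  by case: eqP => // ->; rewrite phin.
have [C phiC] := potential_bound n phi.
have {}phiC i v : `|phi' i v| <= C by apply: phiC; rewrite ltn_pmod.
exists (C + C) => N N0; exists [seq p' i | i <- iota 0 N].
  split; last by rewrite size_map size_iota.
  case: N N0 => // N _ /=; elim: N 0%N => //= N IHN i.
  by rewrite IHN /consecutive pS' eqxx.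
move=> x q y xqy szq.
(* The starting position [i] is generalized because removing the first edge of [q] advances the
   periodic word by one. *)
suff /(_ 0%N) : forall i, phi' (i + N)%N y + a *+ N <=
    phi' i x + b * cost q [seq p' j | j <- iota i N].
  have := phiC 0%N x; have := phiC (0 + N)%N y; rewrite !ler_norml.
  move=> /andP[h1 _] /andP[_ h2] h3. lia.
elim: q N x xqy szq {N0} => [|e q IHq] [|N] // x.
  by move=> /= /eqP -> _ i; rewrite addn0 ?mulr0n ?addr0 /cost big_nil mulr0 ?addr0.
move=> /= /andP[/eqP <- /IHq {}IHq] [{}/IHq IHq] i.
have := IHq i.+1.
rewrite addSnnS cost_cons mulrS mulrDr.
have := phiS' i e; lia.
Qed.

Lemma upper_cert_bound a b m h psi (v0 : vertex G) : upper_cert a b m h psi ->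
  exists C : int, forall x p y, route x p y -> exists z q,
    [/\ route z q v0, size q = size p & b * cost q p <= a *+ size p + C].
Proof.
move=> [hP psiS]; have [C psiC] := potential_bound m psi.
exists (C + C) => x p y xpy; have [j jm hj] := hP x.
(* All end vertices [v] share the same [k], which depends on [p] alone. In the induction, the
   response to the tail of [p] starts at some [z], and the first edge is then chosen to end at
   [z]. *)
suff [k km /(_ v0)[z [q [zq szq le]]]] : exists2 k, (k < m)%N & forall v, exists z q,
    [/\ route z q v, size q = size p &
        psi j z + b * cost q p <= psi k v + a *+ size p].
  exists z, q; split=> //.
  by have := psiC j z jm; have := psiC k v0 km; lia.
elim: p x xpy j jm hj => [|f p IHp] x.
  move=> _ j jm _; exists j => // v; exists v, [::]; split=> //=.
  by rewrite /cost /= big_nil mulr0 ?mulr0n.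
move=> /= /andP[/eqP fx /IHp {}IHp] j jm hj.
have [k [km hk stepk]] := psiS j f jm (etrans fx (esym hj)).
have [l lm lP] := IHp k km hk; exists l => // v.
have [z [q [zqv szq le]]] := lP v.
have [e ez le'] := stepk z.
exists (source e), (e :: q); rewrite /= eqxx ez szq; split=> //.
by rewrite cost_cons mulrDr mulrS; move: le le'; lia.
Qed.

(** * From certificates to the limit *)

Lemma score_cost n (q : n.-tuple (edge G)) (p : n.-tuple (edge H)) :
  score P q p = cost q p.
Proof.
rewrite /score /cost; elim: n q p => [|n IHn] q p.
  by rewrite big_ord0 (size0nil (size_tuple q)) (size0nil (size_tuple p)) big_nil.
case/tupleP: q => e q; case/tupleP: p => f p.
rewrite big_ord_recl /= big_cons !tnth0 -IHn; congr (_ + _).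
by apply: eq_bigr => i _; rewrite !tnthS.
Qed.

(** The initial value of the iterated maximum is the head of the list, itself an entry, so it does
    not affect the result. *)
Lemma maxzP (s : seq int) : s != [::] ->
  maxz s \in s /\ forall z, z \in s -> z <= maxz s.
Proof.
case: s => // z s _; rewrite /maxz; split; last first.
  by move=> y ys; exact: le_bigmax_seq.
rewrite big_cons /= maxEle; case: ifP => _ ; last exact: mem_head.
elim: s => [|y s IHs]; first by rewrite big_nil mem_head.
rewrite big_cons maxEle; case: ifP => _; last by rewrite !inE eqxx orbT.
by move: IHs; rewrite !inE => /orP[->//|->]; rewrite !orbT.
Qed.

Lemma minzP (s : seq int) : s != [::] ->
  minz s \in s /\ forall z, z \in s -> minz s <= z.
Proof.
case: s => // z s _; rewrite /minz; split; last first.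
  by move=> y ys; exact: ge_bigmin_seq.
rewrite big_cons /= minEle; case: ifP => _ ; first exact: mem_head.
elim: s => [|y s IHs]; first by rewrite big_nil mem_head.
rewrite big_cons minEle; case: ifP => _; first by rewrite !inE eqxx orbT.
by move: IHs; rewrite !inE => /orP[->//|->]; rewrite !orbT.
Qed.

Lemma walks_tuple (K : graph) (w : seq (edge K)) : is_walk w ->
  exists2 t : (size w).-tuple (edge K), t \in walks K (size w) & t = w :> seq _.
Proof. by move=> ww; exists (in_tuple w); rewrite ?inE. Qed.

(** Ensures that the inner minimum of [Vn] is over a nonempty list. A route is prolonged by the
    first edge of a closed walk at its end. *)
Lemma walks_of_all_sizes (K : graph) n : primitive K -> (0 < n)%N ->
  exists2 w : seq (edge K), is_walk w & size w = n.
Proof.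
move=> primK n0; have [x] := primitive_vertex primK.
suff [w [y xwy] wn] : exists2 w : seq (edge K), (exists y, route x w y) & size w = n.
  by exists w => //; apply: is_walk_route xwy _; rewrite wn.
elim: n {n0} => [|n [w [y xwy] wn]]; first by exists [::] => //; exists x => /=.
have [[|e w'] // /andP[/eqP ey _] _] := irreducible_route y y primK.1.
exists (rcons w e); last by rewrite size_rcons wn.
exists (target e); rewrite -cats1; apply/route_catP; exists y => //=.
by rewrite ey !eqxx.
Qed.

(** The word of the lower certificate bounds the outer maximum from below; the responses from the
    upper certificate bound every inner minimum from above. *)
Lemma Vn_bounds a b n p phi m h psi : primitive G -> 0 < b ->
  lower_cert a b n p phi -> upper_cert a b m h psi ->
  exists C : int, forall N, (0 < N)%N -> `|b * Vn P N - a *+ N| <= C.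
Proof.
move=> primG b0 /lower_cert_bound[C1 low] up.
have [v0] := primitive_vertex primG.
have {up} [C2 up] := upper_cert_bound v0 up.
exists (Num.max C1 C2) => N N0.
have Gnil : [seq q | q : N.-tuple (edge G) in walks G N] != [::].
  have [w ww wN] := walks_of_all_sizes primG N0.
  have [t tw _] := walks_tuple ww; rewrite wN in t tw.
  by rewrite -size_eq0 size_map -cardE -lt0n; apply/card_gt0P; exists t.
have snil (p' : N.-tuple (edge H)) :
    [seq score P q p' | q : N.-tuple (edge G) in walks G N] != [::].
  by move: Gnil; rewrite -!size_eq0 !size_map.
have [w0 [ww0 w0N] w0P] := low N N0.
have [t0 t0w t0E] := walks_tuple ww0; rewrite w0N in t0 t0w t0E.
pose s := [seq minz [seq score P q p' | q : N.-tuple (edge G) in walks G N]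
  | p' : N.-tuple (edge H) in walks H N].
have sP z : z \in s -> b * z <= a *+ N + C2.
  move=> /mapP[p']; rewrite mem_enum => p'w ->; have [_ minp] := minzP (snil p').
  have p'W : is_walk p' by move: p'w; rewrite inE.
  have [x [y xp'y]] := walk_routeP p'W.
  have [z' [q [z'q szq le]]] := up _ _ _ xp'y.
  have szqN : size q == N by rewrite szq size_tuple.
  apply: le_trans (_ : b * cost q p' <= _); last by move: le; rewrite size_tuple.
  rewrite ler_pM2l // -[q]/(tval (Tuple szqN)) -score_cost minp //.
  apply/mapP; exists (Tuple szqN); rewrite // mem_enum inE; apply: is_walk_route z'q _.
  by rewrite (eqP szqN).
have s_t0 : minz [seq score P q t0 | q : N.-tuple (edge G) in walks G N] \in s.
  by apply/mapP; exists t0; rewrite // mem_enum.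
have [Vs leV] : Vn P N \in s /\ forall z, z \in s -> z <= Vn P N.
  by apply: maxzP; apply/eqP => sE; move: s_t0; rewrite /s sE.
have upV := sP _ Vs.
have lowV : a *+ N <= b * Vn P N + C1.
  have := leV _ s_t0; have [/mapP[q + + _]] := minzP (snil t0).
  rewrite mem_enum => qw ->; rewrite score_cost t0E -(ler_pM2l b0) => le.
  have qW : is_walk q by move: qw; rewrite inE.
  have [x [y xqy]] := walk_routeP qW.
  have := w0P _ _ _ xqy (size_tuple q); move: le; lia.
lia.
Qed.

Lemma V_cert (R : realType) (r : rat) n p phi m h psi : primitive G ->
  lower_cert (numq r) (denq r) n p phi ->
  upper_cert (numq r) (denq r) m h psi -> V P R = ratr r.
Proof.
move=> primG low up.
have [C VC] := Vn_bounds primG (denq_gt0 r) low up.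
have b0 : (0 : R) < (denq r)%:~R by rewrite ltr0z denq_gt0.
rewrite /V; apply: cvg_lim => //; apply/cvgrPdist_le => e e0.
(* The error is at most [C] over [denq r * n], with [denq r] at least 1. Dividing by [C + 1] avoids
   the case [C = 0]. *)
have := @cvg_harmonic R; move=> /cvgrPdist_le /(_ (e / (C%:~R + 1))).
have C0 : (0 : R) <= C%:~R by rewrite ler0z (le_trans _ (VC 1%N isT)).
have C1 : 0 < C%:~R + 1 :> R by lra.
rewrite divr_gt0 // => /(_ isT) [N _ NP].
(* The harmonic sequence at [k] is the inverse of [k.+1], hence the shift by one. *)
exists N.+1 => // -[//|k] /=; rewrite ltnS => Nk.
have := NP k Nk; rewrite /harmonic sub0r normrN gtr0_norm ?invr_gt0 //.
have k0 : 0 < k.+1%:R :> R by rewrite ltr0n.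
rewrite ler_pdivlMr // => le.
have := VC k.+1 isT; rewrite -(ler_int R) intr_norm rmorphB rmorphM /= rmorphMn /=.
rewrite /ratr -[(numq r)%:~R *+ _]mulr_natr.
set x : R := (numq r)%:~R; set d : R := (denq r)%:~R => VCk.
have d1 : 1 <= d by rewrite /d (ler_int R 1) -gtz0_ge1 denq_gt0.
have -> : x / d - (Vn P k.+1)%:~R / k.+1%:R =
    - ((d * (Vn P k.+1)%:~R - x * k.+1%:R) / (d * k.+1%:R)).
  by field; rewrite !lt0r_neq0.
rewrite normrN normrM normfV [X in _ / X]gtr0_norm ?mulr_gt0 //.
rewrite ler_pdivrMr ?mulr_gt0 //.
apply: le_trans VCk _.
have {}le : C%:~R <= e * k.+1%:R.
  move: le; rewrite mulrC ler_pdivrMr // => le; lra.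
apply: le_trans le _.
by rewrite mulrCA ler_peMl // mulr_ge0 ?ltW.
Qed.

End Certificates.

(** * Existence of certificates *)

Lemma closed_route_next (G : graph) (x : vertex G) c e0 i : route x c x -> (i < size c)%N ->
  target (nth e0 c i) = source (nth e0 c (i.+1 %% size c)%N).
Proof.
case: c => // e c; rewrite -is_walk_betweenE => /and3P[/(pathP e0) cP /eqP ex /eqP lx] /=.
rewrite ltnS leq_eqVlt => /orP[/eqP ->|ic].
  by rewrite modnn /= ex -[size c]/(size (e :: c)).-1 nth_last.
by rewrite modn_small ?ltnS //; apply/eqP; exact: cP.
Qed.

(** * Least-cost vectors and their spread *)

Section CostVectors.
Local Open Scope ring_scope.
Variables (G H : graph) (P : edge G -> edge H -> int).
Implicit Types (u : vertex G -> int) (f : edge H) (p : seq (edge H)).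

(* If u v is the least cost of a walk in G ending at v, read against a walk p in
   H, then u' v is the least such cost for p followed by f. *)
Definition step f u u' : Prop :=
  (forall e, u' (target e) <= u (source e) + P e f) /\
  (forall v, exists2 e, target e = v & u (source e) + P e f <= u' v).

Fixpoint run p u u' : Prop :=
  if p is f :: p' then exists2 u1, step f u u1 & run p' u1 u' else u = u'.

(** Each vertex has an incoming edge, the last one of a closed route, so the minimum over incoming
    edges exists. *)
Lemma step_exists f u : irreducible G -> exists u', step f u u'.
Proof.
move=> irrG.
suff /choice [u' u'P] : forall v, exists z,
    (forall e, target e = v -> z <= u (source e) + P e f) /\
    (exists2 e, target e = v & u (source e) + P e f <= z).
  by exists u'; split=> [e|v]; [apply: (u'P _).1 | apply: (u'P v).2].
move=> v; have [p vpv p0] := irreducible_route v v irrG.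
case/lastP: p vpv p0 => // p e0; rewrite -cats1 => /route_catP [x _] /=.
case/andP=> _ e0v _.
case: (@Order.TotalTheory.arg_minP _ _ _ e0 (fun e => target e == v)
  (fun e => u (source e) + P e f) e0v) => e /eqP ev min_e.
exists (u (source e) + P e f); split; last by exists e.
by move=> e' /eqP e'v; apply: min_e.
Qed.

Lemma step_shift f u u' c :
  step f u u' -> step f (fun v => u v + c) (fun v => u' v + c).
Proof.
move=> [le ge]; split=> [e|v]; first by have := le e; lia.
by have [e ev leuv] := ge v; exists e; last by lia.
Qed.

Lemma run_cat p1 p2 u u' : run (p1 ++ p2) u u' ->
  exists2 u1, run p1 u u1 & run p2 u1 u'.
Proof.
elim: p1 u => [|f p1 IHp] u /=; first by exists u.
by move=> [u1 uu1 /IHp [u2 ? ?]]; exists u2 => //; exists u1.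
Qed.

Lemma run_rcons p f u u1 u' : run p u u1 -> step f u1 u' -> run (rcons p f) u u'.
Proof.
elim: p u => [|g p IHp] u /=; first by move=> -> ?; exists u'.
by move=> [u2 uu2 /IHp run1] /run1 ?; exists u2.
Qed.

Section Spread.
Variables (K : int) (K0 : 0 <= K) (PK : forall e f, `|P e f| <= K).

Lemma run_le p u u' x q y : run p u u' -> route x q y -> size q = size p ->
  u' y <= u x + K *+ size p.
Proof.
elim: p u x q => [|f p IHp] u x [|e q] //= => [-> /eqP -> _|].
  by rewrite addr0.
move=> [u1 [le _] run1] /andP[/eqP <- eqy] [/(IHp _ _ _ run1 eqy)].
have := le e; have := PK e f; rewrite mulrS ler_norml => /andP[_]; lia.
Qed.

(** Tracing minimizing edges back from [y] leads to [x]. *)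
Lemma run_near p u u' y : run p u u' -> exists x, `|u' y - u x| <= K *+ size p.
Proof.
elim/last_ind: p u' y => [|p f IHp] u' y /=.
  by move=> ->; exists y; rewrite subrr normr0.
rewrite -cats1 => /run_cat [u1 run1 [u2 [le ge] <-]].
have [e ey leu] := ge y; have [x ux] := IHp _ (source e) run1; exists x.
move: (le e) (PK e f) ux leu; rewrite cats1 size_rcons mulrS ey !ler_norml; lia.
Qed.

(** Let [u1] be the vector [d] letters before the end. An optimal walk to [w] passes at that time
    through some [x], and a route of length [d] leads from [x] to [v]; both entries are within
    [K *+ d] of [u1 x] on the side needed. *)
Lemma run_spread d p u : (forall x y : vertex G, exists2 q, route x q y & size q = d) ->
  run p (fun=> 0) u -> forall v w, u v - u w <= K *+ (2 * d).
Proof.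
move=> dP run_p v w.
have [dp|pd] := leqP d (size p).
  have [u1 _ run2] : exists2 u1, run (take (size p - d) p) (fun=> 0) u1 &
      run (drop (size p - d) p) u1 u by apply: run_cat; rewrite cat_take_drop.
  have sz : size (drop (size p - d) p) = d by rewrite size_drop subKn.
  have [x] := run_near w run2; rewrite sz ler_norml => /andP[ux _].
  have [q xqv szq] := dP x v.
  have := run_le run2 xqv (etrans szq (esym sz)); rewrite sz mulnC mulrnA mulr2n.
  by move: ux; lia.
(* For a word shorter than [d], the entries themselves are still close to the initial value 0. *)
have bound y : `|u y| <= K *+ d.
  have [x] := run_near y run_p; rewrite subr0 => /le_trans; apply.
  by rewrite ler_wpMn2l // ltnW.
have := bound v; have := bound w; rewrite !ler_norml mulnC mulrnA mulr2n; lia.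
Qed.

End Spread.
End CostVectors.

(** * The finite graph of normalized cost vectors *)

Section StateGraph.
Local Open Scope ring_scope.
Variables (G H : graph) (P : edge G -> edge H -> int) (B : nat).

Definition state := (vertex H * {ffun vertex G -> 'I_B.+1})%type.

(* A state represents a cost vector up to an additive constant. *)
Definition pot (s : state) (v : vertex G) : int := (s.2 v : nat)%:Z.

(** The constant [c] is what normalization removes from the new vector; it later serves as the
    weight of the edge. *)
Definition state_step (t : state * edge H * state) : Prop :=
  [/\ source t.1.2 = t.1.1.1, target t.1.2 = t.2.1 &
      exists c : int, step P t.1.2 (pot t.1.1) (fun v => pot t.2 v + c)].

Definition state_graph : graph :=
  @Graph (state : finType) ({t | `[< state_step t >]} : finType)
    (fun t => (val t).1.1) (fun t => (val t).2).

Definition letter (t : edge state_graph) : edge H := (val t).1.2.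

(** The spread is bounded only for vectors obtained from the zero vector, so it is for these states
    that a successor is shown to exist for every outgoing edge of [H]. *)
Definition reachable (s : state) : Prop :=
  exists x p u (c : int),
    [/\ route x p s.1, run P p (fun=> 0) u & forall v, pot s v = u v + c].

End StateGraph.

Section Existence.
Local Open Scope ring_scope.
Variables (G H : graph) (P : edge G -> edge H -> int).
Hypotheses (primG : primitive G) (irrH : irreducible H).

(** Both certificates come from a maximal cycle mean of the state graph: the lower one from a cycle
    attaining it, the upper one from the reachable states, with heaviest incoming routes as
    corrections to the cost vectors. *)
Lemma certs_exist_of_spread (D : nat) (x0 : vertex H) :
  (forall p u, run P p (fun=> 0) u -> forall v w, u v - u w <= D%:Z) ->
  exists r n p phi m h psi,
    lower_cert P (numq r) (denq r) n p phi /\ upper_cert P (numq r) (denq r) m h psi.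
Proof.
move=> spread; pose X := state_graph P (D + D).
have [v0] := primitive_vertex primG.
have reachable0 x : exists2 s : vertex X, reachable P s & s.1 = x.
  exists (x, [ffun=> inord D]) => //; exists x, [::], (fun=> 0), D%:Z.
  by split=> //= v; rewrite /pot ffunE inordK ?add0r // ltnS leq_addr.
have reachableS (s : vertex X) f : reachable P s -> source f = s.1 ->
    exists t : edge X, [/\ source t = s, letter t = f & reachable P (target t)].
  move=> [x [p [u [c [xs run_p su]]]]] fs.
  have [u' uu'] := step_exists P f u primG.1.
  have run_pf := run_rcons run_p uu'.
  (* Vectors are normalized to the value [D] at [v0]; a spread of at most [D] puts all entries
     between 0 and [D + D]. *)
  pose c' := D%:Z - u' v0.
  pose s' : vertex X := (target f, [ffun v => inord `|(u' v + c')%R|%N]).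
  have s'E v : pot s' v = u' v + c'.
    have := spread _ _ run_pf v v0; have := spread _ _ run_pf v0 v.
    by rewrite /pot ffunE /c' => *; rewrite inordK; lia.
  have st : `[< state_step P (s, f, s') >].
    apply/asboolP; split=> //=; exists (c - c').
    have -> : pot s = (fun v => u v + c) by apply/funext.
    have -> : (fun v => pot s' v + (c - c')) = (fun v => u' v + c).
      by apply/funext => v; rewrite s'E; lia.
    exact: step_shift.
  exists (exist (fun t => is_true `[< state_step P t >]) (s, f, s') st : edge X).
  split=> //; exists x, (rcons p f), u', c'; split=> //=.
  by rewrite -cats1; apply/route_catP; exists s.1 => //=; rewrite fs !eqxx.
have /choice [w wP] : forall t : edge X, exists c : int,
    step P (letter t) (pot (source t)) (fun v => pot (target t) v + c).
  by move=> t; have /asboolP[] := valP t.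
have letter_source (t : edge X) : source (letter t) = (source t).1.
  by have /asboolP[] := valP t.
have letter_target (t : edge X) : target (letter t) = (target t).1.
  by have /asboolP[] := valP t.
have [s0 reach0 _] := reachable0 x0.
(* Reachable states can always be continued, which gives the long route required by
   [max_cycle_mean]. *)
have [q [s qs sz]] : exists q : seq (edge X),
    exists2 s, route s0 q s & size q = #|vertex X|.
  suff [q [s [qs sz _]]] : exists q : seq (edge X), exists s,
    [/\ route s0 q s, size q = #|vertex X| & reachable P s] by exists q, s.
  elim: #|_| => [|n [q [s [qs sz reach_s]]]].
    by exists [::], s0; split=> //=.
  have [[|f p] // /andP[/eqP fs _] _] := irreducible_route s.1 s.1 irrH.
  have [t [ts _ reach_t]] := reachableS s f reach_s fs.
  exists (rcons q t), (target t); rewrite size_rcons sz; split=> //.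
  by rewrite -cats1; apply/route_catP; exists s => //=; rewrite -ts /= !eqxx.
have [|r [[c [c0 [z zcz]] sum_c] [C leC]]] := max_cycle_mean w qs; first by rewrite sz.
set a := numq r in sum_c leC *; set b := denq r in sum_c leC *.
have b0 : 0 < b by exact: denq_gt0.
have [t0 _] : exists t0 : edge X, True by case: (c) c0 => // t; exists t.
pose t i := nth t0 c (i %% size c)%N.
have tS i : target (t i) = source (t i.+1).
  rewrite /t (closed_route_next _ zcz) ?ltn_pmod //; congr (source (nth _ _ _)).
  by rewrite -[in LHS]addn1 modnDml addn1.
pose red t := b * w t - a.
(* The sum restores the normalizing constants, less [a] per edge. It vanishes over the whole cycle,
   so the potential closes up. *)
pose phi i v := b * pot (source (t i)) v + \sum_(x <- take i c) red x.
(* [M s] is the largest reduced weight of a route ending at [s], finite by [leC]. Prolonging a route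
   by an edge [t1] shows that [M] grows by at least [red t1] along it. *)
have /choice [M MP] : forall s : vertex X, exists m : int,
    (exists x q, route x q s /\ \sum_(x <- q) red x = m) /\
    forall x q, route x q s -> \sum_(x <- q) red x <= m.
  move=> s1; have [||m mP max_m] := @int_bounded_has_max
      (fun m => exists x q, route x q s1 /\ \sum_(x <- q) red x = m).
  - by exists 0, s1, [::]; rewrite /= eqxx big_nil.
  - by exists C => _ [x [q' [xq <-]]]; exact: leC xq.
  by exists m; split=> // x q' xq'; apply: max_m; exists x, q'.
pose states := [seq s <- enum (vertex X) | `[< reachable P s >]].
have statesP s1 : reachable P s1 -> s1 \in states.
  by move=> reach1; rewrite mem_filter mem_enum andbT; apply/asboolP.
exists r, (size c), (fun i => letter (t i)), phi.
exists (size states), (fun j => (nth s0 states j).1).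
exists (fun j v => b * pot (nth s0 states j) v + M (nth s0 states j)).
split; split.
- exact: c0.
- by rewrite /t modnn mod0n.
- by move=> i _; rewrite letter_source letter_target tS.
- by move=> v; rewrite /phi /t modnn mod0n take_size take0 big_nil sum_c.
- move=> i e ic; have -> : phi i.+1 (target e) =
      b * pot (target (t i)) (target e) + (\sum_(x <- take i c) red x + red (t i)).
    rewrite /phi -tS (take_nth t0) // -cats1 big_cat /= big_seq1.
    by rewrite {3}/t modn_small.
  have [/(_ e) le _] := wP (t i).
  by rewrite /phi /red -/b -/a; nia.
- move=> x; have [s1 /statesP s1s <-] := reachable0 x.
  by exists (index s1 states); rewrite ?index_mem // nth_index.
- move=> j f jm fs.
  have /asboolP reach_j : `[< reachable P (nth s0 states j) >].
    by have := mem_nth s0 jm; rewrite mem_filter => /andP[].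
  have [t1 [t1s t1f reach_t1]] := reachableS _ _ reach_j fs.
  exists (index (target t1) states).
  rewrite index_mem statesP // nth_index ?statesP // -letter_target t1f; split=> //.
  move=> v; have [_ /(_ v) [e ev le]] := wP t1; exists e => //.
  have [[x [q' [xq' qM]]] _] := MP (source t1).
  have : M (source t1) + red t1 <= M (target t1).
    have := (MP (target t1)).2 x (rcons q' t1).
    rewrite -cats1 big_cat big_seq1 qM; apply.
    by apply/route_catP; exists (source t1); rewrite //= !eqxx.
  by rewrite -t1s /red -/b -/a; rewrite t1f in le; nia.
Qed.

Lemma certs_exist : inhabited (vertex H) -> exists r n p phi m h psi,
  lower_cert P (numq r) (denq r) n p phi /\ upper_cert P (numq r) (denq r) m h psi.
Proof.
move=> [x0]; have [d dP] := primitive_routes primG.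
pose K := \sum_e \sum_f `|P e f|.
have K0 : 0 <= K by do 2 apply: sumr_ge0 => ? _.
have PK e f : `|P e f| <= K.
  rewrite /K (bigD1 e) //= (bigD1 f) //= -addrA lerDl addr_ge0 ?sumr_ge0 //.
  by move=> *; apply: sumr_ge0.
apply: (certs_exist_of_spread (D := `|K *+ (2 * d)|%N)) x0 _ => p u run_p v w.
by rewrite gez0_abs ?mulrn_wge0 //; apply: run_spread dP run_p v w.
Qed.

End Existence.

(** * Checking certificates by a program *)

(** [CodeSeq.code] sends [n :: s] to [2 ^ n * m.*2.+1] with [m] the code of [s], so the head is the
    2-adic valuation. It is smaller than a nonzero [c], so [c] rounds reach it. The empty list has
    code 0, which decodes to 0 everywhere, as with [nth 0]. *)
Definition code_head c := iter c (fun n => if odd (iter n half c) then n else n.+1) 0.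
Definition code_tail c := (iter (code_head c) half c)./2.
Definition code_nth c i := code_head (iter i code_tail c).

Lemma iter_half_pow2 n k c : k <= n -> iter k half (2 ^ n * c) = 2 ^ (n - k) * c.
Proof.
elim: k => [|k IHk] kn; first by rewrite subn0.
rewrite iterS IHk 1?ltnW // (_ : n - k = (n - k.+1).+1); last by lia.
by rewrite expnS -mulnA mul2n doubleK.
Qed.

Lemma code_head_cons n m : code_head (2 ^ n * m.*2.+1) = n.
Proof.
rewrite /code_head; set c := 2 ^ n * _.
suff iterE k : iter k (fun i => if odd (iter i half c) then i else i.+1) 0 = minn k n.
  rewrite iterE; apply/minn_idPr; rewrite ltnW // (leq_trans (ltn_expl n (ltnSn 1))) //.
  by rewrite leq_pmulr.
elim: k => [|k IHk]; first by rewrite min0n.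
rewrite iterS IHk; have [nk|kn] := leqP n k.
  rewrite iter_half_pow2 // subnn mul1n /= odd_double.
  by apply/esym/minn_idPr; rewrite leqW.
rewrite iter_half_pow2 1?ltnW // (_ : n - k = (n - k.+1).+1); last by lia.
by rewrite expnS -mulnA mul2n odd_double; apply/esym/minn_idPl.
Qed.

Lemma code_tail_cons n m : code_tail (2 ^ n * m.*2.+1) = m.
Proof.
by rewrite /code_tail code_head_cons iter_half_pow2 // subnn mul1n /= uphalf_double.
Qed.

Lemma code_nthE s i : code_nth (CodeSeq.code s) i = nth 0 s i.
Proof.
elim: s i => [|n s IHs] [|i] //=.
- by rewrite /code_nth; elim: i => //= i IHi; rewrite -iterS iterSr.
- exact: code_head_cons.
- by rewrite -IHs /code_nth iterSr code_tail_cons.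
Qed.

Lemma computable_code_nth k F F' : computable k F -> computable k F' ->
  computable k (fun s => code_nth (F s) (F' s)).
Proof.
have c_half j N F0 : computable j N -> computable j F0 ->
    computable j (fun s => iter (N s) half (F0 s)).
  move=> cN cF0; apply: (computable_iter (g := fun n _ => n./2)) => //.
  exact: computable_half (computable_nth _ _).
have c_head j F0 : computable j F0 -> computable j (fun s => code_head (F0 s)).
  apply: (computable1 (f := code_head)).
  apply: (computable_iter (g := fun n s => if odd (iter n half (nth 0 s 0)) then n else n.+1)
    (computable_nth 1 0) (computable_const 1 0)).
  apply: computable_if; last exact: computable_succ (computable_nth _ _).
    apply/computable_odd/c_half; first exact: computable_nth.
    by apply: (@computable_var _ 1) => s; rewrite nth_behead.
  exact: computable_nth.
have c_tail j F0 : computable j F0 -> computable j (fun s => code_tail (F0 s)).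
  by move=> cF0; apply/computable_half/c_half => //; apply: c_head.
move=> cF cF'; apply/c_head/(computable_iter (g := fun n _ => code_tail n)) => //.
exact: c_tail (computable_nth _ _).
Qed.

(** Recursion on the syntax of the function. The conditional comes last because its pattern matches
    every such goal. *)
Ltac computability := repeat lazymatch goal with
  | |- computable _ (fun s => nat_of_bool (@?A s && @?B s)) => apply: computable_and
  | |- computable _ (fun s => nat_of_bool (@?A s ==> @?B s)) => apply: computable_implb
  | |- computable _ (fun s => nat_of_bool (~~ @?A s)) => apply: computable_not
  | |- computable _ (fun s => nat_of_bool (all _ _)) => apply: computable_all
  | |- computable _ (fun s => nat_of_bool (has _ _)) => apply: computable_has
  | |- computable _ (fun s => nat_of_bool (@?A s <= @?B s)) => apply: computable_leq
  | |- computable _ (fun s => nat_of_bool (@?A s == @?B s)) => apply: computable_eqn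
  | |- computable _ (fun s => nat_of_bool (odd _)) => apply: computable_odd
  | |- computable _ (fun s => code_nth _ _) => apply: computable_code_nth
  | |- computable _ (fun s => @?A s + @?B s) => apply: computable_addn
  | |- computable _ (fun s => @?A s * @?B s) => apply: computable_muln
  | |- computable _ (fun s => @?A s ^ @?B s) => apply: computable_expn
  | |- computable _ (fun s => (@?A s)./2) => apply: computable_half
  | |- computable _ (fun s => (@?A s).+1) => apply: computable_succ
  | |- computable _ (fun s => nth 0 _ _) =>
      apply: computable_var => ?; rewrite ?nth_behead; reflexivity
  | |- computable _ (fun=> ?c) => apply: (@computable_const _ c)
  | |- computable _ _ => apply: computable_if
  end.

(** The checker works in [nat], where subtraction truncates; splitting an integer into two parts
    lets negative terms move across an inequality. *)
Definition pos_part c := if odd c then 0 else c./2.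
Definition neg_part c := if odd c then c./2.+1 else 0.
Definition int_of_code c : int := if odd c then Negz c./2 else Posz c./2.

Lemma int_codeK : cancel int_code int_of_code.
Proof.
by case=> n; rewrite /int_of_code /= odd_double /= ?doubleK ?uphalf_double.
Qed.

Lemma int_of_codeK : cancel int_of_code int_code.
Proof.
move=> c; rewrite /int_of_code -[RHS]odd_double_half.
by case: (odd c).
Qed.

Lemma int_of_code_parts c : (int_of_code c = (pos_part c)%:Z - (neg_part c)%:Z)%R.
Proof. by rewrite /int_of_code /pos_part /neg_part; case: (odd c); lia. Qed.

Lemma absz_int_of_code c : `|int_of_code c|%N = pos_part c + neg_part c.
Proof. by rewrite /int_of_code /pos_part /neg_part; case: (odd c); lia. Qed.

(** Comparison with [nEH] ensures that the numbers read from the witness name edges; the entry at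
    [n] is covered by [p n == p 0]. *)
Definition lower_check (nVG nEG nEH : nat) (sG tG sH tH : nat -> nat)
    (Ppos Pneg : nat -> nat -> nat) (apos aneg b n : nat)
    (p : nat -> nat) (phi : nat -> nat -> nat) : bool :=
  [&& 0 < n, p n == p 0,
      all (fun i => (p i < nEH) && (tH (p i) == sH (p i.+1))) (iota 0 n),
      all (fun v => phi n v == phi 0 v) (iota 0 nVG)
    & all (fun i => all (fun e =>
        phi i.+1 (tG e) + apos + b * Pneg e (p i)
        <= phi i (sG e) + aneg + b * Ppos e (p i)) (iota 0 nEG)) (iota 0 n)].

Definition upper_check (nVG nEG nVH nEH : nat) (sG tG sH tH : nat -> nat)
    (Ppos Pneg : nat -> nat -> nat) (apos aneg b m : nat)
    (h : nat -> nat) (psi : nat -> nat -> nat) : bool :=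
  [&& all (fun j => h j < nVH) (iota 0 m),
      all (fun x => has (fun j => h j == x) (iota 0 m)) (iota 0 nVH)
    & all (fun j => all (fun f => (sH f == h j) ==>
        has (fun k => (h k == tH f) &&
          all (fun v => has (fun e => (tG e == v) &&
            (psi j (sG e) + aneg + b * Ppos e f
             <= psi k v + apos + b * Pneg e f)) (iota 0 nEG)) (iota 0 nVG))
        (iota 0 m)) (iota 0 nEH)) (iota 0 m)].

(* The witness w lists the codes of the numerator and of the denominator, Bezout
   coefficients showing that they are coprime, and the two certificates. *)
Definition check (x w : nat) : bool :=
  let g := code_nth x 0 in let h := code_nth x 1 in
  let nVG := code_nth g 0 in let nEG := code_nth g 1 in
  let nVH := code_nth h 0 in let nEH := code_nth h 1 in
  let sG := code_nth (code_nth g 2) in let tG := code_nth (code_nth g 3) in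
  let sH := code_nth (code_nth h 2) in let tH := code_nth (code_nth h 3) in
  let Ppos e f := pos_part (code_nth (code_nth x 2) (e * nEH + f)) in
  let Pneg e f := neg_part (code_nth (code_nth x 2) (e * nEH + f)) in
  let apos := pos_part (code_nth w 0) in let aneg := neg_part (code_nth w 0) in
  let b := pos_part (code_nth w 1) in
  [&& ~~ odd (code_nth w 1), 0 < b,
      code_nth w 2 * b == code_nth w 3 * (apos + aneg) + 1,
      lower_check nVG nEG nEH sG tG sH tH Ppos Pneg apos aneg b
        (code_nth w 4) (code_nth (code_nth w 5))
        (fun i v => code_nth (code_nth w 6) (i * nVG + v))
    & upper_check nVG nEG nVH nEH sG tG sH tH Ppos Pneg apos aneg b
        (code_nth w 7) (code_nth (code_nth w 8))
        (fun j v => code_nth (code_nth w 9) (j * nVG + v))].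

(** The code of a list of two entries, spelled out in operations already known to be computable. *)
Definition output w := 2 ^ code_nth w 0 * (2 ^ code_nth w 1 * 1 * 2).+1.

Lemma computable_check : computable 2 (fun s => check (nth 0 s 1) (nth 0 s 0)).
Proof.
rewrite /check /lower_check /upper_check /pos_part /neg_part; cbv zeta beta.
by computability.
Qed.

Lemma computable_output : computable 1 (fun s => output (nth 0 s 0)).
Proof. by rewrite /output; computability. Qed.

Lemma outputE w : output w = CodeSeq.code [:: code_nth w 0; code_nth w 1].
Proof. by rewrite /output /= muln2. Qed.

Lemma all_iota n (B : pred nat) :
  all B (iota 0 n) <-> forall i, i < n -> B i.
Proof.
split=> [/allP BP i lt_in|BP]; first by apply: BP; rewrite mem_iota.
by apply/allP => i; rewrite mem_iota => /andP[_ /BP].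
Qed.

Lemma has_iota n (B : pred nat) :
  has B (iota 0 n) <-> exists2 i, i < n & B i.
Proof.
split=> [/hasP[i]|[i lt_in Bi]]; first by rewrite mem_iota => /andP[_ ?]; exists i.
by apply/hasP; exists i => //; rewrite mem_iota.
Qed.

Lemma enum_rankP (T : finType) i : i < #|T| -> exists x : T, i = enum_rank x.
Proof. by move=> lt_i; exists (enum_val (Ordinal lt_i)); rewrite enum_valK. Qed.

Lemma all_enum_rank (T : finType) (B : pred nat) :
  all B (iota 0 #|T|) <-> forall x : T, B (enum_rank x).
Proof.
rewrite all_iota; split=> [BP x|BP i /enum_rankP[x ->]] //.
exact/BP/ltn_ord.
Qed.

Lemma has_enum_rank (T : finType) (B : pred nat) :
  has B (iota 0 #|T|) <-> exists x : T, B (enum_rank x).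
Proof.
rewrite has_iota; split=> [[i /enum_rankP[x ->] Bx]|[x Bx]]; first by exists x.
by exists (enum_rank x).
Qed.

Lemma enum_rank_eq (T : finType) (x y : T) :
  (enum_rank x == enum_rank y :> nat) = (x == y).
Proof. by rewrite (inj_eq val_inj) (inj_eq enum_rank_inj). Qed.

Lemma nth_enum_map (T : finType) (f : T -> nat) x :
  nth 0 [seq f y | y <- enum T] (enum_rank x) = f x.
Proof.
by rewrite (nth_map x) ?nth_enum_rank // -cardE ltn_ord.
Qed.

Lemma nth_allpairs_row (S T U : Type) (f : S -> T -> U) z x0 y0 s t n i j :
  size t = n -> i < size s -> j < n ->
  nth z [seq f x y | x <- s, y <- t] (i * n + j) = f (nth x0 s i) (nth y0 t j).
Proof.
move=> <-; elim: s i => // x s IHs [|i] /= lt_i lt_j; rewrite nth_cat size_map.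
  by rewrite mul0n add0n lt_j (nth_map y0).
by rewrite mulSn -addnA ltnNge leq_addr /= addKn IHs.
Qed.

Section CheckCertificates.
Variables (G H : graph) (P : edge G -> edge H -> int).
Variables (sG tG sH tH : nat -> nat) (Ppos Pneg : nat -> nat -> nat).
Hypotheses (sGE : forall e : edge G, sG (enum_rank e) = enum_rank (source e))
  (tGE : forall e : edge G, tG (enum_rank e) = enum_rank (target e))
  (sHE : forall f : edge H, sH (enum_rank f) = enum_rank (source f))
  (tHE : forall f : edge H, tH (enum_rank f) = enum_rank (target f))
  (PE : forall e f, ((Ppos (enum_rank e) (enum_rank f))%:Z -
                     (Pneg (enum_rank e) (enum_rank f))%:Z)%R = P e f).
Variables (apos aneg b : nat).

(** Tables hold natural numbers, potentials are integers. Every condition compares one potential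
    with another, so a common shift [C] is harmless. *)
Lemma lower_checkE n (p : nat -> edge H) (p' : nat -> nat)
    (phi : nat -> vertex G -> int) (phi' : nat -> nat -> nat) (C : int) :
  (forall i, i <= n -> p' i = enum_rank (p i)) ->
  (forall i v, (i <= n)%N -> (phi' i (enum_rank v))%:Z = phi i v + C)%R ->
  lower_check #|vertex G| #|edge G| #|edge H| sG tG sH tH Ppos Pneg apos aneg b n p' phi'
  <-> lower_cert P (apos%:Z - aneg%:Z)%R b%:Z n p phi.
Proof.
move=> p'E phi'E; rewrite /lower_check /lower_cert.
split=> [/and5P[n0 /eqP pn /all_iota tP /all_enum_rank phin /all_iota phiS]|
         [n0 pn tP phin phiS]].
- split=> // [|i lt_in|v|i e lt_in].
  + by move: pn; rewrite !p'E // => /val_inj/enum_rank_inj.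
  + have /andP[_] := tP i lt_in.
    by rewrite (p'E i (ltnW lt_in)) (p'E i.+1 lt_in) sHE tHE enum_rank_eq => /eqP.
  + have /eqP := phin v => phi0.
    by have := phi'E n v (leqnn n); rewrite phi0 phi'E // => /addIr.
  + have /all_enum_rank /(_ e) := phiS i lt_in.
    rewrite sGE tGE (p'E i (ltnW lt_in)) -PE mulrBr.
    have := phi'E _ (source e) (ltnW lt_in); have := phi'E _ (target e) lt_in.
    lia.
- apply/and5P; split=> //.
  + by rewrite !p'E // pn.
  + apply/all_iota => i lt_in.
    rewrite (p'E i (ltnW lt_in)) (p'E i.+1 lt_in) sHE tHE enum_rank_eq tP //.
    by rewrite ltn_ord eqxx.
  + apply/all_enum_rank => v; rewrite -eqz_nat.
    by rewrite !phi'E // phin.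
  + apply/all_iota => i lt_in; apply/all_enum_rank => e.
    have := phiS i e lt_in; rewrite sGE tGE (p'E i (ltnW lt_in)) -PE mulrBr.
    have := phi'E _ (source e) (ltnW lt_in); have := phi'E _ (target e) lt_in.
    lia.
Qed.

Lemma upper_checkE m (h : nat -> vertex H) (h' : nat -> nat)
    (psi : nat -> vertex G -> int) (psi' : nat -> nat -> nat) (C : int) :
  (forall j, j < m -> h' j = enum_rank (h j)) ->
  (forall j v, (j < m)%N -> (psi' j (enum_rank v))%:Z = psi j v + C)%R ->
  upper_check #|vertex G| #|edge G| #|vertex H| #|edge H|
    sG tG sH tH Ppos Pneg apos aneg b m h' psi'
  <-> upper_cert P (apos%:Z - aneg%:Z)%R b%:Z m h psi.
Proof.
move=> h'E psi'E; rewrite /upper_check /upper_cert.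
split=> [/and3P[_ /all_enum_rank hP /all_iota psiP]|[hP psiP]].
- split=> [x|j f jm fj].
    have /has_iota[j jm /eqP] := hP x.
    by rewrite h'E // => /val_inj/enum_rank_inj; exists j.
  have /all_enum_rank /(_ f) := psiP j jm.
  rewrite sHE h'E // fj eqxx => /has_iota[k km /andP[/eqP hk /all_enum_rank kP]].
  exists k; split=> // [|v].
    by move: hk; rewrite tHE h'E // => /val_inj/enum_rank_inj.
  have /has_enum_rank[e] := kP v; rewrite tGE enum_rank_eq sGE => /andP[/eqP ev le].
  exists e => //; have := psi'E j (source e) jm; have := psi'E k v km.
  by move: le; rewrite -PE mulrBr; lia.
- apply/and3P; split.
  + by apply/all_iota => j jm; rewrite h'E.
  + apply/all_enum_rank => x; apply/has_iota; have [j jm <-] := hP x.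
    by exists j => //; rewrite h'E.
  + apply/all_iota => j jm; apply/all_enum_rank => f; apply/implyP.
    rewrite sHE h'E // enum_rank_eq => /eqP fj.
    have [k [km hk kP]] := psiP j f jm fj.
    apply/has_iota; exists k => //; rewrite h'E // tHE hk eqxx andTb.
    apply/all_enum_rank => v; apply/has_enum_rank; have [e ev le] := kP v.
    exists e; rewrite tGE sGE ev eqxx andTb.
    have := psi'E j (source e) jm; have := psi'E k v km.
    by move: le; rewrite -PE mulrBr; lia.
Qed.

End CheckCertificates.

(** * Soundness and completeness of the checker *)

Section Instance.
Variables (G H : graph) (P : edge G -> edge H -> int).
Let x := instance_code P.
Let Pcode e f := code_nth (code_nth x 2) (e * #|edge H| + f).
Let Ppos e f := pos_part (Pcode e f).
Let Pneg e f := neg_part (Pcode e f).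

Lemma instance_cost e f :
  ((Ppos (enum_rank e) (enum_rank f))%:Z -
   (Pneg (enum_rank e) (enum_rank f))%:Z)%R = P e f.
Proof.
rewrite -int_of_code_parts /Pcode /x /instance_code !code_nthE /=.
rewrite -[RHS]int_codeK (nth_allpairs_row _ _ e f) ?nth_enum_rank //; by rewrite -cardE.
Qed.

Lemma checkE w : check x w =
  [&& ~~ odd (code_nth w 1), 0 < pos_part (code_nth w 1),
      code_nth w 2 * pos_part (code_nth w 1) ==
        code_nth w 3 * `|int_of_code (code_nth w 0)| + 1,
      lower_check #|vertex G| #|edge G| #|edge H|
        (code_nth (code_nth (graph_code G) 2)) (code_nth (code_nth (graph_code G) 3))
        (code_nth (code_nth (graph_code H) 2)) (code_nth (code_nth (graph_code H) 3))
        Ppos Pneg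
        (pos_part (code_nth w 0)) (neg_part (code_nth w 0)) (pos_part (code_nth w 1))
        (code_nth w 4) (code_nth (code_nth w 5))
        (fun i v => code_nth (code_nth w 6) (i * #|vertex G| + v))
    & upper_check #|vertex G| #|edge G| #|vertex H| #|edge H|
        (code_nth (code_nth (graph_code G) 2)) (code_nth (code_nth (graph_code G) 3))
        (code_nth (code_nth (graph_code H) 2)) (code_nth (code_nth (graph_code H) 3))
        Ppos Pneg
        (pos_part (code_nth w 0)) (neg_part (code_nth w 0)) (pos_part (code_nth w 1))
        (code_nth w 7) (code_nth (code_nth w 8))
        (fun j v => code_nth (code_nth w 9) (j * #|vertex G| + v))].
Proof.
rewrite absz_int_of_code /check /Ppos /Pneg /Pcode.
have -> : code_nth x 0 = graph_code G by rewrite code_nthE.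
have -> : code_nth x 1 = graph_code H by rewrite code_nthE.
have nV (K : graph) : code_nth (graph_code K) 0 = #|vertex K| by rewrite code_nthE.
have nE (K : graph) : code_nth (graph_code K) 1 = #|edge K| by rewrite code_nthE.
by rewrite !nV !nE.
Qed.

Lemma source_code (K : graph) (e : edge K) :
  code_nth (code_nth (graph_code K) 2) (enum_rank e) = enum_rank (source e).
Proof. by rewrite /graph_code !code_nthE nth_enum_map. Qed.

Lemma target_code (K : graph) (e : edge K) :
  code_nth (code_nth (graph_code K) 3) (enum_rank e) = enum_rank (target e).
Proof. by rewrite /graph_code !code_nthE nth_enum_map. Qed.

Lemma check_sound (R : realType) w : primitive G -> check x w ->
  exists r : rat, V P R = ratr r /\ output w = rat_code r.
Proof.
move=> primG; rewrite checkE => /and5P[even_b b0 /eqP bez low up].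
set ca := code_nth w 0 in bez low up; set cb := code_nth w 1 in even_b b0 bez low up.
set b := pos_part cb in b0 bez low up; set a := int_of_code ca in bez.
(* The fraction must be in lowest terms, since the output has to be the code of the numerator and
   denominator of [r] itself. *)
have cop : coprime `|a| `|Posz b|.
  rewrite absz_nat coprime_sym; apply/(coprimeP _ b0).
  by exists (code_nth w 2, code_nth w 3); rewrite /= bez addKn.
pose r := (a%:~R / b%:Z%:~R : rat)%R.
have num_r : numq r = a by rewrite /r coprimeq_num // gtr0_sg ?mul1r.
have den_r : denq r = Posz b.
  by rewrite /r coprimeq_den // eqz_nat gtn_eqF.
exists r; split; last first.
  rewrite outputE /rat_code num_r den_r /a int_of_codeK; congr (CodeSeq.code [:: _; _]).
  rewrite -[LHS]/cb -[LHS]int_of_codeK int_of_code_parts.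
  by rewrite /neg_part (negbTE even_b) subr0.
have [n0 _ pP _ _] := and5P low.
have [hP _ _] := and3P up.
(* A filler for indices beyond the tables, where the certificates impose nothing. *)
have [f0 _] : exists f0 : edge H, True.
  by have /all_iota /(_ 0 n0)/andP[/enum_rankP[f0 _] _] := pP; exists f0.
have /choice [p pE] : forall i, exists f : edge H,
    i <= code_nth w 4 -> code_nth (code_nth w 5) i = enum_rank f.
  move=> i; have [lt_i|gt_i|->] := ltngtP i (code_nth w 4).
  - by have /all_iota /(_ i lt_i)/andP[/enum_rankP[f ->] _] := pP; exists f.
  - by exists f0.
  - have [_ /eqP -> _ _ _] := and5P low.
    by have /all_iota /(_ 0 n0)/andP[/enum_rankP[f ->] _] := pP; exists f.
have /choice [h hE] : forall j, exists y : vertex H,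
    j < code_nth w 7 -> code_nth (code_nth w 8) j = enum_rank y.
  move=> j; have [lt_j|_] := ltnP j (code_nth w 7); last by exists (source f0).
  by have /all_iota /(_ j lt_j)/enum_rankP[y ->] := hP; exists y.
pose phi i (v : vertex G) := (code_nth (code_nth w 6) (i * #|vertex G| + enum_rank v))%:Z%R.
pose psi j (v : vertex G) := (code_nth (code_nth w 9) (j * #|vertex G| + enum_rank v))%:Z%R.
apply: (@V_cert _ _ P R r (code_nth w 4) p phi (code_nth w 7) h psi) => //.
  rewrite num_r den_r /a int_of_code_parts.
  apply: (iffLR (@lower_checkE _ _ P _ _ _ _ Ppos Pneg (@source_code G) (@target_code G)
    (@source_code H) (@target_code H) instance_cost _ _ _ _ _ _ _ _ 0%R pE _)) low.
  by move=> i v _; rewrite addr0.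
rewrite num_r den_r /a int_of_code_parts.
apply: (iffLR (@upper_checkE _ _ P _ _ _ _ Ppos Pneg (@source_code G) (@target_code G)
  (@source_code H) (@target_code H) instance_cost _ _ _ _ _ _ _ _ 0%R hE _)) up.
by move=> j v _; rewrite addr0.
Qed.

Definition table_code m (phi : nat -> vertex G -> int) (C : int) : nat :=
  CodeSeq.code [seq `|(phi i v + C)%R|%N | i <- iota 0 m, v <- enum (vertex G)].

Lemma table_codeE m phi C i v : (forall i v, i < m -> (`|phi i v| <= C)%R) -> i < m ->
  (code_nth (table_code m phi C) (i * #|vertex G| + enum_rank v))%:Z%R = (phi i v + C)%R.
Proof.
move=> phiC lt_im; rewrite code_nthE.
rewrite (nth_allpairs_row _ _ 0 v) ?size_iota //; last by rewrite -cardE.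
rewrite nth_iota // nth_enum_rank gez0_abs //.
by have := phiC i v lt_im; rewrite ler_norml -lerBlDr sub0r => /andP[].
Qed.

Lemma check_complete : primitive G -> primitive H -> exists w, check x w.
Proof.
move=> primG primH.
have [r [n [p [phi [m [h [psi [low up]]]]]]]] :=
  certs_exist P primG primH.1 (primitive_vertex primH).
(* The lower certificate also uses row [n], so its table has [n.+1] rows. *)
have [C phiC] := potential_bound n.+1 phi.
have [C' psiC] := potential_bound m psi.
have den0 : 0 < `|denq r| by rewrite absz_gt0.
have := coprime_num_den r; rewrite coprime_sym.
move=> /(coprimeP _ den0) [[k l] /= kl].
pose p' := CodeSeq.code [seq nat_of_ord (enum_rank (p i)) | i <- iota 0 n.+1].
pose h' := CodeSeq.code [seq nat_of_ord (enum_rank (h j)) | j <- iota 0 m].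
pose w := CodeSeq.code [:: int_code (numq r); int_code (denq r); k; l;
  n; p'; table_code n.+1 phi C; m; h'; table_code m psi C'].
(* Entries of [w] are read through decoding, so that its arithmetic value is never unfolded. *)
have wE i : code_nth w i = nth 0 (CodeSeq.decode w) i.
  by rewrite -[w in LHS]CodeSeq.decodeK code_nthE.
rewrite /w CodeSeq.codeK -/w in wE.
have odd_den : ~~ odd (int_code (denq r)).
  by have := denq_gt0 r; case: (denq r) => //= d _; rewrite odd_double.
have den_part : (pos_part (int_code (denq r)))%:Z%R = denq r.
  rewrite -[RHS]int_codeK int_of_code_parts /neg_part (negbTE odd_den).
  by rewrite subr0.
exists w; rewrite checkE !wE /=; apply/and5P; split=> //.
- by rewrite -ltz_nat den_part denq_gt0.
- rewrite int_codeK -[pos_part _]absz_nat den_part; apply/eqP; lia.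
- apply/(@lower_checkE _ _ P _ _ _ _ Ppos Pneg (@source_code G) (@target_code G)
    (@source_code H) (@target_code H) instance_cost _ _ _ _ p _ phi _ C).
  + move=> i lt_i; rewrite code_nthE (nth_map 0) ?size_iota ?nth_iota //.
  + by move=> i v lt_i; rewrite table_codeE.
  + by rewrite -int_of_code_parts int_codeK den_part.
- apply/(@upper_checkE _ _ P _ _ _ _ Ppos Pneg (@source_code G) (@target_code G)
    (@source_code H) (@target_code H) instance_cost _ _ _ _ h _ psi _ C').
  + by move=> j lt_j; rewrite code_nthE (nth_map 0) ?size_iota ?nth_iota.
  + by move=> j v lt_j; rewrite table_codeE.
  + by rewrite -int_of_code_parts int_codeK den_part.
Qed.

End Instance.

Theorem theoremC (R : realType) :
  (forall (G H : graph) (P : edge G -> edge H -> int),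
     primitive G -> primitive H ->
     exists q : rat, V P R = ratr q) /\
  (exists A : recfun 1,
     forall (G H : graph) (P : edge G -> edge H -> int),
       primitive G -> primitive H ->
       exists q : rat,
         V P R = ratr q /\
         evaluates A [tuple instance_code P] (rat_code q)).
Proof.
split=> [G H P primG primH|].
  have [w /(check_sound R primG)[q [VE _]]] := check_complete P primG primH.
  by exists q.
have [A AP] := evaluates_search computable_check computable_output.
exists A => G H P primG primH.
(* The search may stop at another witness than the constructed one; soundness holds for every
   accepted witness. *)
have [w /(check_sound R primG)[q [VE outE]] Aw] := AP _ (check_complete P primG primH).
by exists q; split; rewrite // -outE.
Qed.
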